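(* Let $X$ be a locally convex space over $\mathbb{K}$ ($\mathbb{K}=\mathbb{R}$ or $\mathbb{C}$). If $T\in GL(X)$ is topologically stable, then $T$ has the finite shadowing property and the strict periodic shadowing property.
   Context: All topological vector spaces are Hausdorff. $\mathbb{N}_0=\{0,1,2,\dots\}$. $GL(X)$ is the set of continuous linear operators on $X$ having a continuous inverse. $T\in GL(X)$ is topologically stable if for every neighborhood $V$ of $0$ in $X$ there is a neighborhood $U$ of $0$ in $X$ such that for every (not necessarily linear) homeomorphism $S:X\to X$ with $Tx-Sx\in U$ for all $x\in X$, there is a continuous map $\phi:X\to X$ with $T\circ\phi=\phi\circ S$ and $\phi(x)-x\in V$ for all $x\in X$. For a neighborhood $U$ of $0$, a $U$-chain for $T$ is a finite sequence $(x_j)_{j=0}^k$ ($k\ge1$) with $Tx_j-x_{j+1}\in U$ for $0\le j<k$; a sequence $(x_j)_{j\in\mathbb{N}_0}$ with $Tx_j-x_{j+1}\in U$ for all $j$ is a $U$-pseudotrajectory. $T$ has the finite shadowing property if for every neighborhood $V$ of $0$ there is a neighborhood $U$ of $0$ such that for every $U$-chain $(x_j)_{j=0}^k$ there is $x\in X$ with $x_j-T^jx\in V$ for all $0\le j\le k$. $T$ has the strict periodic shadowing property if for every neighborhood $V$ of $0$ there is a neighborhood $U$ of $0$ such that for every periodic $U$-pseudotrajectory $(x_j)_{j\in\mathbb{N}_0}$, of period $k$, there is $x\in X$ with $T^kx=x$ and $x_j-T^jx\in V$ for all $j\in\mathbb{N}_0$. *)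

(* Defs.v *)
From mathcomp Require Import all_boot all_order all_algebra.
From mathcomp Require Import all_classical all_reals all_analysis.

Set Implicit Arguments.
Unset Strict Implicit.
Unset Printing Implicit Defensive.

Import GRing.Theory.

Local Open Scope classical_set_scope.
Local Open Scope ring_scope.

Definition homeomorphism (X : topologicalType) (f : X -> X) : Prop :=
  continuous f /\
  exists g : X -> X, [/\ continuous g, cancel f g & cancel g f].

Section Dynamics.
(* tvsType K is the library's structure of locally convex space over K. It also
   carries a uniformity compatible with the topology; only the topology is used
   below. It does not include the Hausdorff axiom. *)
Context (K : numDomainType) (X : tvsType K).

(* For a linear bijection the inverse is automatically linear, so T is in GL(X)
   exactly when it is a homeomorphism. *)
Definition in_GL (T : {linear X -> X}) : Prop := homeomorphism T.

Definition topologically_stable (T : X -> X) : Prop :=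
  forall V : set X, nbhs 0 V ->
  exists2 U : set X, nbhs 0 U &
    forall S : X -> X, homeomorphism S -> (forall x, U (T x - S x)) ->
    exists phi : X -> X,
      [/\ continuous phi, T \o phi =1 phi \o S & forall x, V (phi x - x)].

(* The finite sequence (x_0, ..., x_k) is given by a function on nat whose
   values beyond k are irrelevant. *)
Definition is_chain (T : X -> X) (U : set X) (k : nat) (x : nat -> X) : Prop :=
  (1 <= k)%N /\ forall j, (j < k)%N -> U (T (x j) - x j.+1).

Definition pseudotrajectory (T : X -> X) (U : set X) (x : nat -> X) : Prop :=
  forall j, U (T (x j) - x j.+1).

(* k is any positive period, not necessarily the least one. *)
Definition has_period (k : nat) (x : nat -> X) : Prop :=
  (1 <= k)%N /\ forall j, x (j + k)%N = x j.

Definition finite_shadowing (T : X -> X) : Prop :=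
  forall V : set X, nbhs 0 V ->
  exists2 U : set X, nbhs 0 U &
    forall (k : nat) (x : nat -> X), is_chain T U k x ->
    exists y : X, forall j, (j <= k)%N -> V (x j - iter j T y).

Definition strict_periodic_shadowing (T : X -> X) : Prop :=
  forall V : set X, nbhs 0 V ->
  exists2 U : set X, nbhs 0 U &
    forall (k : nat) (x : nat -> X), pseudotrajectory T U x -> has_period k x ->
    exists y : X, iter k T y = y /\ forall j, V (x j - iter j T y).

End Dynamics.

(* Main.v *)
(* A pseudo-orbit (x_j) is shadowed by perturbing T into S = h o T, where h is a
   homeomorphism close to the identity that moves each T x_j to the next point:
   if T o phi = phi o S, then phi (x_0) is the initial point of an orbit of T
   close to (x_j). In real dimension at least 2 take, by Hahn-Banach, functionals
   f, g and a vector e with f e = 1, g e = 0, g != 0. After a small generic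
   displacement of the points (along a line, so that a closed pseudo-orbit stays
   closed) f separates the T x_j and g separates the x_j, and h is a composite of
   two shears z + G (f z) and z + G' (g z), which preserve f and g respectively.
   On the real line order obstructs such an h; there T is multiplication by some
   a, stability forces |a| <> 1, and shadowing follows by direct estimates. *)

Require Import Defs.
From HB Require Import structures.
From mathcomp Require Import all_boot all_order all_algebra.
From mathcomp Require Import all_classical all_reals all_analysis.
From mathcomp.real_closed Require Import complex.
From mathcomp Require Import ring lra.

Set Implicit Arguments.
Unset Strict Implicit.
Unset Printing Implicit Defensive.

Import Order.TTheory GRing.Theory Num.Theory.
Import numFieldNormedType.Exports.

Local Open Scope classical_set_scope.
Local Open Scope ring_scope.

(** * Continuity of operations and neighborhoods of 0 in a locally convex space *)

Section LocallyConvex.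
Context (R : realType) (X : tvsType R).
Implicit Types (U V W : set X) (f g : {scalar X}).

Lemma tvs_continuousD (S : topologicalType) (h k : S -> X) :
  continuous h -> continuous k -> continuous (fun s => h s + k s).
Proof.
move=> ch ck s; apply: continuous2_cvg; [|exact: ch|exact: ck].
exact: (add_continuous (h s, k s)).
Qed.

Lemma tvs_continuousN (S : topologicalType) (h : S -> X) :
  continuous h -> continuous (fun s => - h s).
Proof.
move=> ch s; apply: (@continuous_comp _ _ _ h -%R); first exact: ch.
exact: opp_continuous.
Qed.

Lemma tvs_continuousZ (S : topologicalType) (a : S -> R) (h : S -> X) :
  continuous a -> continuous h -> continuous (fun s => a s *: h s).
Proof.
move=> ca ch s.
apply: (@continuous2_cvg S R^o X X _ _ a h (fun (t : R) (x : X) => t *: x)).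
  exact: (scale_continuous (a s : R^o, h s)).
- exact: ca.
- exact: ch.
Qed.

Lemma tvs_continuous_sum (S : topologicalType) I (r : seq I) (h : I -> S -> X) :
  (forall i, continuous (h i)) -> continuous (fun s => \sum_(i <- r) h i s).
Proof.
move=> ch; elim: r => [|i r IHr].
  by under eq_fun do rewrite big_nil; move=> s; exact: cvg_cst.
by under eq_fun do rewrite big_cons; exact: tvs_continuousD.
Qed.

Lemma nbhs0D U : nbhs 0 U ->
  exists2 W, nbhs 0 W & forall x y, W x -> W y -> U (x + y).
Proof.
move=> U0; have /= := add_continuous ((0 : X), (0 : X)).
rewrite /continuous_at /= addr0 => /(_ U U0)[] [A B] /= [A0 B0] ABU.
by exists (A `&` B); [exact: filterI|move=> x y [Ax _] [_ By]; exact: (ABU (x, y))].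
Qed.

Lemma nbhs0_absorbing U x : nbhs 0 U ->
  exists2 e : R, 0 < e & forall t, `|t| < e -> U (t *: x).
Proof.
move=> U0; have /= := scale_continuous ((0 : R^o), x).
rewrite /continuous_at /= scale0r => /(_ U U0)[] [A B] /= [/nbhs_ballP[e e0 eA]].
move=> /nbhs_singleton Bx ABU; exists e => // t te; apply: (ABU (t, x)); split => //=.
by apply: eA; rewrite -ball_normE /= sub0r normrN.
Qed.

(** Continuity of scaling at [(0, 0)] gives [e] and [B] such that all [t *: y] with [|t| < e] and
    [y] in [B] lie in [U]; these products form a balanced set, which contains [(e / 2) B]. *)
Lemma nbhs0_balanced U : nbhs 0 U ->
  exists W, [/\ nbhs 0 W, W `<=` U & forall a x, `|a| <= 1 -> W x -> W (a *: x)].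
Proof.
move=> U0; have /= := scale_continuous ((0 : R^o), (0 : X)).
rewrite /continuous_at /= scaler0 => /(_ U U0)[] [A B] /= [/nbhs_ballP[e /= e0 eA]].
move=> B0 ABU; have e20 : 0 < e / 2 by rewrite divr_gt0.
exists [set x | exists t y, [/\ `|t| < e, B y & x = t *: y]]; split.
- apply: (filterS (P := [set (e / 2) *: y | y in B])); last first.
    by apply: nbhs0Z => //; rewrite gt_eqF.
  move=> _ [y By <-] /=; exists (e / 2), y; split => //.
  by rewrite gtr0_norm// gtr_pMr// invf_lt1// ltr1n.
- move=> _ [t [y [te By ->]]]; apply: (ABU (t, y)); split => //=.
  by apply: eA; rewrite -ball_normE /= sub0r normrN.
- move=> a _ a1 [t [y [te By ->]]]; exists (a * t), y; rewrite scalerA; split => //.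
  by rewrite normrM (le_lt_trans _ te)// ler_piMl.
Qed.

Lemma nbhs0_convex U : nbhs 0 U ->
  exists W, [/\ nbhs 0 W, W `<=` U, (forall x, W x -> W (- x)) &
    forall a x y, 0 <= a <= 1 -> W x -> W y -> W (a *: x + (1 - a) *: y)].
Proof.
move=> U0; have [B Bconvex [Bopen Bbasis]] := @locally_convex R X.
have [b [Bb b0] bU] := Bbasis _ _ U0.
have nb : nbhs (0 : X) b by apply: open_nbhs_nbhs; split => //; exact: Bopen.
have cb (a : R) (x y : X) : 0 <= a <= 1 -> b x -> b y -> b (a *: x + (1 - a) *: y).
  move=> /andP[a0 a1] bx by_.
  (* Convexity of basic sets is phrased with coefficients bundled with their membership in [[0, 1]],
     so [a] has to be packaged. *)
  have ai : Itv.spec (@Itv.num_sem _) (Itv.Real `[0%Z, 1%Z]) a.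
    by rewrite /= /Itv.num_sem /= num_real /= in_itv /= a0 a1.
  have bB : b \in B by rewrite inE.
  have := Bconvex b bB (x : convex_lmodType X) y (Itv.mk ai).
  by rewrite !inE; apply.
exists (b `&` [set - x | x in b]); split.
- by apply: filterI => //; exact: nbhs0N.
- by move=> x [] /bU.
- by move=> x [bx [y by_ yx]]; split; [rewrite -yx opprK|exists x].
- move=> a x y a01 [bx [x' bx' xx']] [by_ [y' by' yy']]; split.
    exact: cb.
  exists (a *: x' + (1 - a) *: y'); first exact: cb.
  by rewrite -xx' -yy' opprD !scalerN.
Qed.

End LocallyConvex.

(** * Hahn-Banach extension *)

Section HahnBanach.
Context (R : realType) (X : tvsType R) (V : set X).
Hypothesis V0 : nbhs 0 V.
Hypothesis convexV :
  forall a x y, 0 <= a <= 1 -> V x -> V y -> V (a *: x + (1 - a) *: y).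

(** Partial functionals are encoded by their graphs, so that extension is inclusion and Zorn's lemma
    applies to unions of chains. *)
Let linear_graph (F : set (X * R)) :=
  forall a x y r s, F (x, r) -> F (y, s) -> F (a *: x + y, a * r + s).

(* A bound on V replaces domination by a gauge; it forces the relation F to be
   the graph of a function. *)
Let bounded_graph (F : set (X * R)) := forall x r, F (x, r) -> V x -> r <= 1.

Lemma linear_graph_zero (F : set (X * R)) x r :
  linear_graph F -> F (x, r) -> F (0, 0).
Proof.
by move=> lF Fx; have := lF (-1) _ _ _ _ Fx Fx; rewrite scaleN1r mulN1r !addNr.
Qed.

Lemma linear_graphZ (F : set (X * R)) a x r :
  linear_graph F -> F (x, r) -> F (a *: x, a * r).
Proof.
move=> lF Fx; have := lF a _ _ _ _ Fx (linear_graph_zero lF Fx).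
by rewrite !addr0.
Qed.

(** Two values at [x] would put [(0, r - s)] in [F], hence [(0, 2)] after rescaling, against the
    bound 1 at the point [0] of [V]. *)
Lemma bounded_graph_function (F : set (X * R)) x r s :
  linear_graph F -> bounded_graph F -> F (x, r) -> F (x, s) -> r = s.
Proof.
move=> lF bF Fr Fs.
have Frs : F (0, r - s).
  by have := lF (-1) _ _ _ _ Fs Fr; rewrite scaleN1r mulN1r addNr addrC.
apply/eqP; rewrite -subr_eq0; apply/negPn/negP => rs.
have := bF _ _ (linear_graphZ (2 / (r - s)) lF Frs).
rewrite scaler0 divfK// => /(_ (nbhs_singleton V0)).
by rewrite leNgt ltr1n.
Qed.

(** The value [c] at [z] is bounded below by the elements of [A], coming from points [x - s *: z] of
    [V], and above by [(1 - r') / t], coming from points [y + t *: z]. By [A_le] the bounds are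
    compatible, so [sup A] serves. *)
Lemma bounded_graph_extension (F : set (X * R)) z :
  linear_graph F -> bounded_graph F -> F (0, 0) ->
  exists c, bounded_graph
    [set p | exists x r t, F (x, r) /\ p = (x + t *: z, r + t * c)].
Proof.
move=> lF bF F0.
pose A := [set a | exists x r s,
  [/\ F (x, r), 0 < s, V (x - s *: z) & a = (r - 1) / s]].
have A_le a y r' t : A a -> F (y, r') -> 0 < t -> V (y + t *: z) ->
    a <= (1 - r') / t.
  move=> [x [r [s [Fx s0 Vx ->]]]] Fy t0 Vy.
  have st0 : 0 < s + t by rewrite addr_gt0.
  (* With these weights the [z]-terms of [x - s *: z] and [y + t *: z] cancel, so the convex
     combination lies in the domain of [F]. *)
  have := lF (t / (s + t)) _ _ _ _ Fx (linear_graphZ (s / (s + t)) lF Fy).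
  have st1 : 1 - t / (s + t) = s / (s + t) by field; rewrite gt_eqF.
  move=> /bF; have -> : t / (s + t) *: x + s / (s + t) *: y =
      t / (s + t) *: (x - s *: z) + (1 - t / (s + t)) *: (y + t *: z).
    rewrite st1 scalerBr scalerDr !scalerA addrACA -[LHS]addr0; congr (_ + _).
    by rewrite (_ : s / (s + t) * t = t / (s + t) * s) ?addNr//; ring.
  have t01 : 0 <= t / (s + t) <= 1.
    by rewrite divr_ge0 ?(ltW t0) ?(ltW st0)//= ler_pdivrMr// mul1r lerDr ltW.
  move=> /(_ (convexV t01 Vx Vy)).
  rewrite mulrAC [s / _ * _]mulrAC -mulrDl ler_pdivrMr// mul1r => h.
  by rewrite ler_pdivrMr// mulrAC ler_pdivlMr//; lra.
have [e e0 eV] := nbhs0_absorbing z V0.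
have e20 : 0 < e / 2 by rewrite divr_gt0.
have e2e : `|e / 2| < e by rewrite gtr0_norm// gtr_pMr// invf_lt1// ltr1n.
have supA : has_sup A.
  split.
    exists ((0 - 1) / (e / 2)), 0, 0, (e / 2); split => //.
    by rewrite sub0r -scaleNr; apply: eV; rewrite normrN.
  exists ((1 - 0) / (e / 2)) => a Aa; apply: A_le Aa F0 e20 _.
  by rewrite add0r; apply: eV.
exists (sup A) => _ _ [x [r [t [Fx [-> ->]]]]] Vx.
have [t0|t0|t0] := ltgtP t 0.
- have : (r - 1) / (- t) <= sup A.
    apply: ub_le_sup; first exact: (proj2 supA).
    by exists x, r, (- t); rewrite oppr_gt0 scaleNr opprK.
  by rewrite ler_pdivrMr ?oppr_gt0//; lra.
- have : sup A <= (1 - r) / t.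
    by apply: ge_sup; [exact: (proj1 supA)|move=> a Aa; exact: A_le Aa Fx t0 Vx].
  by rewrite ler_pdivlMr//; lra.
- by move: Vx; rewrite t0 scale0r mul0r !addr0; exact: bF.
Qed.

Theorem hahn_banach (e : X) : ~ V e ->
  exists f : {scalar X}, f e = 1 /\ forall x, V x -> f x <= 1.
Proof.
move=> Ve.
(* The last clause is conditional because the union of the empty chain, which is empty, must satisfy
   [P]. *)
pose P (F : set (X * R)) :=
  [/\ linear_graph F, bounded_graph F & F !=set0 -> F (e, 1)].
have P_line : P [set p | p.1 = p.2 *: e].
  split.
  - by move=> a x y r s /= -> ->; rewrite scalerA -scalerDl.
  - move=> x r /= -> Vre; rewrite leNgt; apply/negP => r1; apply: Ve.
    have r0 : 0 < r by exact: lt_trans r1.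
    have ri : 0 <= r^-1 <= 1 by rewrite invr_ge0 (ltW r0)/= invf_le1// ltW.
    have := convexV ri Vre (nbhs_singleton V0).
    by rewrite scaler0 addr0 scalerA mulVf ?gt_eqF// scale1r.
  - by move=> _ /=; rewrite scale1r.
have [F [[lF bF Fe] Fmax]] : exists F, P F /\ forall G, F `<` G -> ~ P G.
  apply: Zorn_bigcup => C CP Ctot; split.
  - move=> a x y r s [F CF Fx] [G CG Gy].
    have [FG|GF] := Ctot _ _ CF CG.
      by exists G => //; have [lG _ _] := CP _ CG; apply: lG => //; exact: FG.
    by exists F => //; have [lF _ _] := CP _ CF; apply: lF => //; exact: GF.
  - by move=> x r [F CF Fx]; have [_ bF _] := CP _ CF; exact: bF.
  - move=> [p [F CF Fp]]; exists F => //; have [_ _ Fe] := CP _ CF.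
    by apply: Fe; exists p.
have {}Fe : F (e, 1).
  apply: Fe; apply/set0P/negP => /eqP F0.
  apply: (Fmax _ _ P_line); rewrite F0; split => // /(_ (e, 1)); apply => /=.
  by rewrite scale1r.
have F0 := linear_graph_zero lF Fe.
(* Otherwise the extension by [z] would be a strictly larger graph satisfying [P]. *)
have Ftotal z : exists c, F (z, c).
  have [c bG] := bounded_graph_extension z lF bF F0.
  exists c; apply: contrapT => Fzc.
  set G := [set p | _] in bG.
  have FG : F `<=` G.
    by move=> [x r] Fx; exists x, r, 0; rewrite scale0r mul0r !addr0.
  have Gz : G (z, c) by exists 0, 0, 1; rewrite scale1r mul1r !add0r.
  apply: (Fmax G); first by split => // GF; apply: Fzc; exact: GF.
  split => //; last by move=> _; exact: FG.
  move=> a _ _ _ _ [x [r [t [Fx [-> ->]]]]] [y [s [u [Fy [-> ->]]]]].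
  exists (a *: x + y), (a * r + s), (a * t + u); split; first exact: lF.
  congr (_, _); first by rewrite scalerDr scalerDl addrACA scalerA.
  by ring.
have [f Ff] := choice Ftotal.
have f_linear : scalar f.
  by move=> a x y; apply: (bounded_graph_function lF bF) (Ff _) _; exact: lF.
pose g : {scalar X} := HB.pack f (GRing.isLinear.Build R X R *%R f f_linear).
exists g; split; first exact: (bounded_graph_function lF bF) (Ff _) Fe.
by move=> x; exact: bF.
Qed.

End HahnBanach.

Section Functionals.
Context (R : realType) (X : tvsType R).

Lemma bounded_scalar_continuous (f : {scalar X}) (W : set X) : nbhs 0 W ->
  (forall x, W x -> `|f x| <= 1) -> continuous f.
Proof.
move=> W0 fW x; apply/cvgrPdist_le => e e0; near=> y.
have : [set x + z | z in [set e *: w | w in W]] y.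
  by near: y; apply: nbhsT; apply: nbhs0Z => //; rewrite gt_eqF.
move=> [_ [w Ww <-] <-]; rewrite linearD /= opprD addNKr normrN linearZ /=.
by rewrite normrM gtr0_norm// ler_piMr ?(ltW e0)// fW.
Unshelve. all: by end_near. Qed.

(** Hahn-Banach is applied to a convex symmetric neighborhood missing [e]; symmetry turns the
    one-sided bound into [|f| <= 1], whence continuity. *)
Lemma exists_functional (e : X) : hausdorff_space X -> e != 0 ->
  exists f : {scalar X}, continuous f /\ f e = 1.
Proof.
move=> hX e0.
have [U U0 Ue] : exists2 U : set X, nbhs 0 U & ~ U e.
  have := hX; rewrite open_hausdorff => /(_ _ _ e0)[[A B] /=].
  rewrite !inE => -[Ae B0] [oA oB AB].
  exists B; first by apply: open_nbhs_nbhs.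
  by move=> Be; have : (A `&` B) e by []; rewrite AB.
have [V [V0 VU VN convexV]] := nbhs0_convex U0.
have [f [fe fV]] := hahn_banach V0 convexV (fun Ve => Ue (VU _ Ve)).
exists f; split => //; apply: (bounded_scalar_continuous V0) => x Vx.
by rewrite ler_norml fV// andbT lerNl -linearN fV//; exact: VN.
Qed.

End Functionals.

(** * Small generic displacements *)

Section SmallScalars.
Context (R : realType).

Lemma near0_affine_neq0 (a b : R) : b != 0 ->
  \forall s \near 0^'+, a + s * b != 0.
Proof.
move=> b0; have [c0|c0] := ltP 0 (- a / b).
- near=> s; have s0 : 0 < s by near: s; exact: nbhs_right_gt.
  have sc : s < - a / b by near: s; exact: nbhs_right_lt.
  apply/eqP => h; move: sc; rewrite (_ : s = - a / b) ?ltxx//.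
  by apply: (mulIf b0); rewrite divfK//; lra.
- near=> s; have s0 : 0 < s by near: s; exact: nbhs_right_gt.
  apply/eqP => h; have : s <= 0; last by rewrite leNgt s0.
  rewrite (_ : s = - a / b)//.
  by apply: (mulIf b0); rewrite divfK//; lra.
Unshelve. all: by end_near. Qed.

(** The difference of the values at [i] and [j] is affine in [s] with slope [(i - j) * f d], nonzero
    for [i != j]. Each of the finitely many pairs thus excludes at most one [s]. *)
Lemma near0_separated (X : lmodType R) (f : {scalar X}) (n : nat) (x : nat -> X) d :
  f d != 0 -> \forall s \near 0^'+, forall i j, (i < n)%N -> (j < n)%N ->
    f (x i + (s * i%:R) *: d) = f (x j + (s * j%:R) *: d) -> i = j.
Proof.
move=> fd.
have : \forall s \near 0^'+, forall ij : 'I_n * 'I_n, ij.1 != ij.2 ->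
    (f (x ij.1) - f (x ij.2)) + s * ((ij.1%:R - ij.2%:R) * f d) != 0.
  apply: filter_forall => -[i j] /=; have [->|ij] := eqVneq i j; first exact: nearW.
  have b0 : (i%:R - j%:R) * f d != 0 by rewrite mulf_neq0// subr_eq0 eqr_nat.
  by apply: filterS (near0_affine_neq0 (f (x i) - f (x j)) b0).
apply: filterS => s sP i j im jm; rewrite !linearD !linearZ /= => e.
apply/eqP/negPn/negP => ij.
have := sP (Ordinal im, Ordinal jm) ij; rewrite /= => /eqP; apply.
have := e; lra.
Qed.

Lemma near0_scale (X : tvsType R) (U : set X) (u : X) : nbhs 0 U ->
  \forall s \near 0^'+, U (s *: u).
Proof.
move=> U0; have [e e0 eU] := nbhs0_absorbing u U0.
near=> s; apply: eU; rewrite gtr0_norm; first by near: s; exact: nbhs_right_lt.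
by near: s; exact: nbhs_right_gt.
Unshelve. all: by end_near. Qed.

End SmallScalars.

(** * Interpolation by tent functions *)

Section Interpolation.
Context (R : realType).

Definition tent (d t : R) : R := Num.max 0 (1 - `|t| / d).

Lemma tent_continuous d : continuous (tent d).
Proof.
move=> t; apply: (@continuous_max R R (fun=> 0) (fun t => 1 - `|t| / d)).
  exact: cst_continuous.
apply: (@continuousB R R^o R (fun=> 1) (fun t => `|t| / d)).
  exact: cst_continuous.
apply: (@continuousM R R (fun t => `|t|) (fun=> d^-1)).
  exact: norm_continuous.
exact: cst_continuous.
Qed.

Lemma tent0 d : tent d 0 = 1.
Proof. by rewrite /tent normr0 mul0r subr0 max_r. Qed.

Lemma tent_le1 d t : 0 < d -> `|tent d t| <= 1.
Proof.
move=> d0; rewrite ger0_norm /tent; last by rewrite le_max lexx.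
by rewrite ge_max ler01 lerBlDr lerDl divr_ge0// ltW.
Qed.

Lemma tent_out d t : 0 < d -> d <= `|t| -> tent d t = 0.
Proof.
by move=> d0 dt; rewrite /tent max_l// subr_le0 ler_pdivlMr// mul1r.
Qed.

(** The nodes are at least [2d] apart, so tents of radius [d] do not overlap and each value of [G]
    involves a single [v j]. Hence [G] stays in any balanced set and in any kernel containing all
    the [v j]. *)
Lemma tent_interpolation (X : tvsType R) (m : nat) (t : nat -> R) (v : nat -> X) :
  (forall i j, (i < m)%N -> (j < m)%N -> t i = t j -> i = j) ->
  exists G : R -> X, [/\ continuous G, forall j, (j < m)%N -> G (t j) = v j &
    forall s, G s = 0 \/ exists2 j, (j < m)%N & exists2 c, `|c| <= 1 & G s = c *: v j].
Proof.
move=> t_inj.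
have [d [d0 dP]] : exists d : R, 0 < d /\ forall i j, (i < m)%N -> (j < m)%N ->
    i != j -> d + d <= `|t i - t j|.
  have : \forall d \near 0^'+, forall ij : 'I_m * 'I_m, ij.1 != ij.2 ->
      d + d <= `|t ij.1 - t ij.2|.
    apply: filter_forall => -[i j] /=.
    have [->|ij] := eqVneq i j; first exact: nearW.
    have tij : 0 < `|t i - t j| / 2.
      rewrite divr_gt0// normr_gt0 subr_eq0; apply: contra ij => /eqP.
      by move=> /(t_inj _ _ (ltn_ord i) (ltn_ord j)) /val_inj ->.
    near=> d => _; have : d < `|t i - t j| / 2 by near: d; exact: nbhs_right_lt.
    by lra.
  move=> /(filterI (nbhs_right_gt 0)) /filter_ex [d [d0 dP]]; exists d; split => // i j im jm ij.
  exact: (dP (Ordinal im, Ordinal jm)).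
pose G s := \sum_(j < m) tent d (s - t j) *: v j.
have Gj s (j : 'I_m) : `|s - t j| < d -> G s = tent d (s - t j) *: v j.
  move=> sj; rewrite /G (bigD1 j)//= big1 ?addr0// => i ij.
  rewrite tent_out ?scale0r//.
  have := dP _ _ (ltn_ord i) (ltn_ord j) ij.
  have : `|t i - t j| <= `|s - t i| + `|s - t j|.
    by rewrite -[t i - t j](_ : - (s - t i) + (s - t j) = _) ?(le_trans (ler_normD _ _)) ?normrN//; ring.
  by lra.
exists G; split.
- apply: tvs_continuous_sum => j.
  apply: tvs_continuousZ => s; last exact: cvg_cst.
  apply: (@continuous_comp _ _ _ (fun s => s - t j) (tent d)).
    apply: (@continuousB R R^o R id (fun=> t j)); first exact: cvg_id.
    exact: cst_continuous.
  exact: tent_continuous.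
- move=> j jm; rewrite (Gj _ (Ordinal jm)) /= subrr ?tent0 ?scale1r//.
  by rewrite normr0.
- move=> s; have [[j sj]|ns] := pselect (exists j : 'I_m, `|s - t j| < d).
    right; exists j => //; exists (tent d (s - t j)); last exact: Gj.
    exact: tent_le1.
  left; rewrite /G big1// => j _; rewrite tent_out ?scale0r// leNgt; apply/negP => sj.
  by apply: ns; exists j.
Unshelve. all: by end_near. Qed.

End Interpolation.

Lemma periodic_modn (T : Type) (x : nat -> T) k : (forall j, x (j + k)%N = x j) ->
  forall j, x (j %% k)%N = x j.
Proof.
move=> xk j; rewrite {2}(divn_eq j k) addnC; elim: (j %/ k)%N => [|q IHq].
  by rewrite mul0n addn0.
by rewrite mulSn addnA addnAC xk.
Qed.

Lemma homeomorphism_comp (X : topologicalType) (f g : X -> X) :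
  homeomorphism f -> homeomorphism g -> homeomorphism (f \o g).
Proof.
move=> [cf [f' [cf' fK f'K]]] [cg [g' [cg' gK g'K]]].
split; first by move=> x; apply: continuous_comp; [exact: cg|exact: cf].
exists (g' \o f'); split => [x|x|x]; last 2 first.
- by rewrite /= fK gK.
- by rewrite /= g'K f'K.
by apply: continuous_comp; [exact: cf'|exact: cg'].
Qed.

(** * Shears and homeomorphisms moving finitely many points *)

Section Shears.
Context (R : realType) (X : tvsType R).
Implicit Types (f : {scalar X}) (U V : set X).

Lemma shear_continuous f (G : R -> X) : continuous f -> continuous G ->
  continuous (fun z => z + G (f z)).
Proof.
move=> cf cG; apply: tvs_continuousD => z; first exact: cvg_id.
by apply: continuous_comp; [exact: cf|exact: cG].
Qed.

(** Since [G] takes values in the kernel of [f], the shear preserves [f], and subtracting [G (f z)]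
    undoes it. *)
Lemma shear_homeomorphism f (G : R -> X) : continuous f -> continuous G ->
  (forall t, f (G t) = 0) -> homeomorphism (fun z => z + G (f z)).
Proof.
move=> cf cG fG; split; first exact: shear_continuous.
exists (fun z => z + - G (f z)); split.
- by apply: (@shear_continuous f (fun t => - G t)) => //; exact: tvs_continuousN.
- by move=> z /=; rewrite linearD fG addr0 addrK.
- by move=> z /=; rewrite linearB /= fG subr0 subrK.
Qed.

Lemma shear_moving_points f U : nbhs 0 U -> continuous f ->
  (forall a x, `|a| <= 1 -> U x -> U (a *: x)) ->
  forall (m : nat) (a v : nat -> X),
    (forall j, (j < m)%N -> U (v j)) -> (forall j, (j < m)%N -> f (v j) = 0) ->
    (forall i j, (i < m)%N -> (j < m)%N -> f (a i) = f (a j) -> i = j) ->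
  exists G : R -> X, [/\ homeomorphism (fun z => z + G (f z)),
    forall t, U (G t) & forall j, (j < m)%N -> G (f (a j)) = v j].
Proof.
move=> U0 cf balU m a v Uv fv fa_inj.
have [G [cG Gv Gs]] := tent_interpolation v fa_inj.
exists G; split => //.
- apply: shear_homeomorphism => // t; have [->|[j jm [c _ ->]]] := Gs t.
    by rewrite linear0.
  by rewrite linearZ /= fv// mulr0.
- move=> t; have [->|[j jm [c c1 ->]]] := Gs t; first exact: nbhs_singleton.
  by apply: balU => //; exact: Uv.
Qed.

(* The first shear corrects the points modulo e, using values in the kernel of
   f; it does not affect g, along which the second one corrects the component
   in direction e. *)
Lemma homeomorphism_moving_points (f g : {scalar X}) (e : X) U :
  continuous f -> continuous g -> f e = 1 -> g e = 0 -> nbhs 0 U ->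
  exists2 W, nbhs 0 W & forall (m : nat) (a b : nat -> X),
    (forall j, (j < m)%N -> W (a j - b j)) ->
    (forall i j, (i < m)%N -> (j < m)%N -> f (a i) = f (a j) -> i = j) ->
    (forall i j, (i < m)%N -> (j < m)%N -> g (b i) = g (b j) -> i = j) ->
  exists h : X -> X, [/\ homeomorphism h, forall j, (j < m)%N -> h (a j) = b j &
    forall z, U (z - h z)].
Proof.
move=> cf cg fe ge U0.
have [U1 U10 U1U] := nbhs0D U0.
have [U2 [U20 U2U1 balU2]] := nbhs0_balanced U10.
have U2N x : U2 x -> U2 (- x).
  by rewrite -scaleN1r; apply: balU2; rewrite normrN1.
have ce : continuous (fun z => f z *: e).
  by apply: tvs_continuousZ => // z; exact: cvg_cst.
have ck : continuous (fun z => z + - (f z *: e)).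
  by apply: tvs_continuousD; [move=> z; exact: cvg_id|exact: tvs_continuousN].
(* Both the [e]-component of a displacement and the remainder must be small: up to sign they are the
   values prescribed for [G2] and [G1]. *)
exists [set d | U2 (f d *: e) /\ U2 (d - f d *: e)].
  apply: filterI.
    by apply: (ce 0); rewrite linear0 scale0r.
  by apply: (ck 0); rewrite linear0 scale0r subrr.
move=> m a b Wab fa_inj gb_inj.
pose d j := b j - a j.
have dE j : d j = - (a j - b j) by rewrite opprB.
have [j jm||G1 [hG1 UG1 G1a]] :=
  shear_moving_points U20 cf balU2 (v := fun j => d j - f (d j) *: e) _ _ fa_inj.
- rewrite dE linearN /= scaleNr -opprD; apply: U2N; exact: (Wab j jm).2.
- by move=> j _; rewrite linearB linearZ /= fe mulr1 subrr.
(* The first shear sends [a j] to [b j - f (d j) *: e]; as [g e = 0], these intermediate points are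
   still separated by [g]. *)
have gb j : g (b j - f (d j) *: e) = g (b j).
  by rewrite linearB linearZ /= ge mulr0 subr0.
have [||i j im jm|G2 [hG2 UG2 G2a]] :=
  shear_moving_points U20 cg balU2 (m := m) (a := fun j => b j - f (d j) *: e)
    (v := fun j => f (d j) *: e).
- by move=> j jm; rewrite dE linearN scaleNr; apply: U2N; exact: (Wab j jm).1.
- by move=> j _; rewrite linearZ /= ge mulr0.
- by rewrite !gb; exact: gb_inj.
exists ((fun z => z + G2 (g z)) \o (fun z => z + G1 (f z))); split.
- exact: homeomorphism_comp.
- move=> j jm /=; rewrite G1a//.
  have -> : a j + (d j - f (d j) *: e) = b j - f (d j) *: e.
    by rewrite addrA /d addrC (addrC (a j)) subrK addrC.
  by rewrite G2a// subrK.
- move=> z /=; rewrite opprD addrA opprD addrA subrr add0r.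
  by apply: U1U; apply: U2U1; apply: U2N.
Qed.

End Shears.

(** * Shadowing in real dimension at least 2 *)

Section HigherDimension.
Context (R : realType) (X : tvsType R) (T : {linear X -> X}).
Hypotheses (GL_T : in_GL T) (stableT : topologically_stable T).
Context (f g : {scalar X}) (e w : X).
Hypotheses (cf : continuous f) (cg : continuous g).
Hypotheses (fe : f e = 1) (ge : g e = 0) (gw : g w = 1).

(** The preimage of [e] under [T] meets the first condition and [w] the second; if each fails the
    other one, their sum meets both. *)
Lemma direction_separated : exists d, f (T d) != 0 /\ g d != 0.
Proof.
have [_ [T' [_ _ T'K]]] := GL_T.
have [fw|] := eqVneq (f (T w)) 0; last by exists w; rewrite gw oner_neq0.
have [gu|] := eqVneq (g (T' e)) 0; last by exists (T' e); rewrite T'K fe oner_neq0.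
by exists (T' e + w); rewrite !linearD /= T'K fe fw gu gw addr0 add0r oner_neq0.
Qed.

(** The map [s] gives the index of the next point, so that open chains ([s j = j + 1]) and cycles
    ([s j = j + 1] modulo the period) are treated together; only the first [m] of the [n] points
    need a successor. *)
Lemma pseudo_orbit_shadowing (V : set X) : nbhs 0 V ->
  exists2 U : set X, nbhs 0 U & forall (n m : nat) (s : nat -> nat) (x : nat -> X),
    (m <= n)%N -> (forall j, (j < m)%N -> (s j < n)%N) ->
    (forall i j, (i < m)%N -> (j < m)%N -> s i = s j -> i = j) ->
    (forall j, (j < m)%N -> U (T (x j) - x (s j))) ->
  exists y : nat -> X, (forall j, (j < m)%N -> T (y j) = y (s j)) /\
    forall j, (j < n)%N -> V (x j - y j).
Proof.
move=> V0.
have [V1 V10 V1V] := nbhs0D V0.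
(* Stability controls [phi x - x], whereas shadowing needs the opposite difference. *)
have V1N : nbhs (0 : X) [set - x | x in V1] by exact: nbhs0N.
have [U1 U10 stable] := stableT V1N.
have [U2 U20 moving] := homeomorphism_moving_points cf cg fe ge U10.
have [U U0 UU2] := nbhs0D U20.
exists U => // n m s x mn sn s_inj Ux.
have [d [fd gd]] := direction_separated.
pose p r j : X := x j + (r * j%:R) *: d.
pose fT : {scalar X} := f \o T.
have [r [fp_inj gp_inj p_x Tp_p]] : exists r, [/\
  forall i j, (i < m)%N -> (j < m)%N -> f (T (p r i)) = f (T (p r j)) -> i = j,
  forall i j, (i < n)%N -> (j < n)%N -> g (p r i) = g (p r j) -> i = j,
  forall j, (j < n)%N -> V1 (x j - p r j) &
  forall j, (j < m)%N -> U2 (T (p r j) - p r (s j))].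
  (* Each of the four requirements holds for all sufficiently small [r > 0], hence some [r] meets
     them all. *)
  have h1 := @near0_separated R X fT m x d fd.
  have h2 := @near0_separated R X g n x d gd.
  have h3 : \forall r \near 0^'+, forall j : 'I_n, V1 (r *: (- (j%:R *: d))).
    by apply: filter_forall => j; exact: near0_scale.
  have h4 : \forall r \near 0^'+, forall j : 'I_m,
      U (r *: (j%:R *: T d - (s j)%:R *: d)).
    by apply: filter_forall => j; exact: near0_scale.
  have [r [[r1 r2] [r3 r4]]] := filter_ex (filterI (filterI h1 h2) (filterI h3 h4)).
  exists r; split => //.
  - by move=> j jn; have := r3 (Ordinal jn); rewrite /p opprD addrA subrr add0r scalerN scalerA.
  - move=> j jm; rewrite /p linearD linearZ /= opprD addrACA; apply: UU2.
      exact: Ux.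
    by have := r4 (Ordinal jm); rewrite scalerBr !scalerA.
have [h [hom_h hTp hU]] := moving m (fun j => T (p r j)) (fun j => p r (s j)) Tp_p fp_inj
  (fun i j im jm e => s_inj _ _ im jm (gp_inj _ _ (sn _ im) (sn _ jm) e)).
(* The perturbation [h \o T] sends [p r j] exactly to [p r (s j)], so [phi] carries the displaced
   points to pieces of true orbits of [T]. *)
have [phi [_ Tphi phiV]] := stable (h \o T) (homeomorphism_comp hom_h GL_T) (fun z => hU (T z)).
exists (fun j => phi (p r j)); split.
- by move=> j jm; have := Tphi (p r j); rewrite /= hTp.
- move=> j jn; rewrite -[x j - _](subrKA (p r j)); apply: V1V; first exact: p_x.
  by have [u V1u ue] := phiV (p r j); rewrite -opprB -ue opprK.
Qed.

Lemma finite_shadowing_higher_dim : finite_shadowing T.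
Proof.
move=> V V0; have [U U0 shadow] := pseudo_orbit_shadowing V0.
exists U => // k x [k1 chain].
(* There are [k.+1] points, the last of which has no prescribed successor. *)
have [//|i j _ _ []//|y [Ty xy]] := shadow k.+1 k succn x (leqnSn k) _ _ chain.
exists (y 0%N) => j jk.
have -> : iter j T (y 0%N) = y j; last exact: xy.
elim: j jk => // j IHj jk /=; rewrite IHj ?Ty//; exact: ltnW.
Qed.

Lemma periodic_shadowing_higher_dim : strict_periodic_shadowing T.
Proof.
move=> V V0; have [U U0 shadow] := pseudo_orbit_shadowing V0.
exists U => // k x pseudo [k0 xk].
have s_inj i j : (i < k)%N -> (j < k)%N -> (i.+1 %% k)%N = (j.+1 %% k)%N -> i = j.
  move=> ik jk /eqP; rewrite -[i.+1]addn1 -[j.+1]addn1 eqn_modDr.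
  by rewrite !modn_small// => /eqP.
have [||y [Ty xy]] :=
  shadow k k (fun j => j.+1 %% k)%N x (leqnn k) _ s_inj _.
- by move=> j _; rewrite ltn_mod.
- by move=> j _; rewrite (periodic_modn xk).
have yE j : iter j T (y 0%N) = y (j %% k)%N.
  elim: j => [|j IHj]; first by rewrite mod0n.
  by rewrite iterS IHj Ty ?ltn_mod// -addn1 modnDml addn1.
exists (y 0%N); split; first by rewrite yE modnn.
by move=> j; rewrite yE -(periodic_modn xk j); apply: xy; rewrite ltn_mod.
Qed.

End HigherDimension.

(** * Error estimates for multiplication by a real number *)

Section RealDynamics.
Context (R : realType).
Implicit Types (a k M : R) (t : nat -> R).

Lemma contraction_chain_bound a k M t n : `|a| * M + k <= M ->
  (forall j, (j < n)%N -> `|a * t j - t j.+1| <= k) -> `|t 0%N| <= M ->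
  forall j, (j <= n)%N -> `|t j| <= M.
Proof.
move=> aM tk t0; elim=> // j IHj jn.
have tj : `|a| * `|t j| <= `|a| * M by rewrite ler_wpM2l// IHj// ltnW.
have := tk j jn; rewrite distrC => /(le_trans (lerB_dist _ _)).
by rewrite normrM; lra.
Qed.

(** Backward induction: [|a| |t_j| <= |t_(j+1)| + k <= M + k <= |a| M]. *)
Lemma expansion_chain_bound a k M t n : M + k <= `|a| * M -> 0 < `|a| ->
  (forall j, (j < n)%N -> `|a * t j - t j.+1| <= k) -> `|t n| <= M ->
  forall j, (j <= n)%N -> `|t j| <= M.
Proof.
move=> aM a0 tk tn j jn; rewrite -(subKn jn); elim: (n - j)%N (leq_subr j n) => [|i IHi] iltn.
  by rewrite subn0.
have lt_n : (n - i.+1 < n)%N by rewrite ltn_subrL (leq_ltn_trans _ iltn).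
have := tk _ lt_n; rewrite subnSK// => /(le_trans (lerB_dist _ _)).
rewrite normrM => tn_i; have IH := IHi (ltnW iltn).
by rewrite -(ler_pM2l a0); lra.
Qed.

(** At an index where [|t|] is maximal, comparison with the next and the previous term bounds
    [(|a| - 1) |t_i|] and its opposite by [k]. *)
Lemma periodic_chain_bound a k M t n : 0 < M -> k = M * `|1 - `|a| | -> `|a| != 1 ->
  (forall j, `|a * t j - t j.+1| <= k) -> (0 < n)%N -> (forall j, t (j + n)%N = t j) ->
  forall j, `|t j| <= M.
Proof.
move=> M0 kE a1 tk n0 tn.
have [i it] : exists i, forall j, `|t j| <= `|t i|.
  case: (@arg_maxP _ _ _ (Ordinal n0) xpredT (fun i : 'I_n => `|t i|)) => // i _ it.
  by exists i => j; rewrite -(periodic_modn tn); exact: (it (Ordinal (ltn_pmod j n0))).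
move=> j; apply: le_trans (it j) _.
have h1 : `|a| * `|t i| - `|t i| <= k.
  have := le_trans (lerB_dist _ _) (tk i); rewrite normrM.
  by have := it i.+1; lra.
have h2 : `|t i| - `|a| * `|t i| <= k.
  (* By periodicity [i + n.-1] acts as the predecessor of [i], also when [i = 0]. *)
  have := tk (i + n.-1)%N; rewrite -addnS prednK// tn distrC.
  move=> /(le_trans (lerB_dist _ _)); rewrite normrM.
  by have := ler_wpM2l (normr_ge0 a) (it (i + n.-1)%N); lra.
have a10 : 0 < `|1 - `|a| | by rewrite normr_gt0 subr_eq0 eq_sym.
rewrite -(ler_pM2r a10) -kE -[`|t i|]normr_id -normrM.
by rewrite ler_norml mulrBr mulr1 [_ * `|a|]mulrC; lra.
Qed.

End RealDynamics.

(** * Restriction of scalars from the complex to the real numbers *)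

Definition realified (R : realType) (X : tvsType R[i]) : Type := X.

Section Realified.
Context (R : realType) (X : tvsType R[i]).
Local Notation Y := (realified X).

HB.instance Definition _ := Uniform.on Y.
HB.instance Definition _ := TopologicalZmodule.on Y.

(** The alias [realified X] keeps the topology and the addition of [X], and lets this real scaling
    coexist with the complex one. *)
Definition rscale (a : R) (x : Y) : Y := (a%:C%C : R[i]) *: (x : X).

Fact rscaleA a b x : rscale a (rscale b x) = rscale (a * b) x.
Proof. by rewrite /rscale scalerA rmorphM. Qed.
Fact rscale1 : left_id 1 rscale.
Proof. by move=> x; rewrite /rscale scale1r. Qed.
Fact rscaleDr : right_distributive rscale +%R.
Proof. by move=> a x y; rewrite /rscale scalerDr. Qed.
Fact rscaleDl x : {morph rscale^~ x : a b / a + b}.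
Proof. by move=> a b; rewrite /rscale rmorphD scalerDl. Qed.

HB.instance Definition _ :=
  GRing.Zmodule_isLmodule.Build R Y rscaleA rscale1 rscaleDr rscaleDl.

Lemma realified_scale_continuous : continuous (fun z : R^o * Y => z.1 *: z.2).
Proof.
move=> [a x] U /= U0; have /= := scale_continuous ((a%:C%C : R[i]^o), (x : X)).
move=> /(_ U U0)[] [A B] /= [/nbhs_ballP[e /= e0 eA]] Bx ABU.
(* A positive element of [R[i]] is real, so [e] equals its real part. *)
exists (ball (a : R) (complex.Re e), B) => /=.
  split => //; apply: nbhsx_ballx; move: e0; rewrite ltcE /= => /andP[] //.
move=> [b y] /= [ab By]; apply: (ABU (b%:C%C, y)); split => //=.
apply: eA; move: ab; rewrite -!ball_normE /= -rmorphB /=.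

case: e e0 => e1 e2; rewrite ltcE /= => /andP[/eqP e20 e10] ab.
rewrite normc_def /= expr0n /= addr0 sqrtr_sqr e20.
by rewrite ltcE /= eqxx ab.
Qed.

HB.instance Definition _ := TopologicalZmodule_isTopologicalLmodule.Build R Y realified_scale_continuous.
Lemma realified_locally_convex : exists2 B : set_system Y,
    (forall b, b \in B -> convex_set b) & basis B.
Proof.
have [B Bconvex Bbasis] := @locally_convex R[i] X; exists B => //.
move=> b bB x y l xb yb.
have li : Itv.spec (@Itv.num_sem _) (Itv.Real `[0%Z, 1%Z]) (l%:num%:C%C : R[i]).
  have l0 : 0 <= (l%:num%:C%C : R[i]) by rewrite lecR.
  rewrite /= /Itv.num_sem /= in_itv /=; apply/and3P; split; [exact: ger0_real|exact: l0|].
  by rewrite -[1%Z%:~R]/((1 : R)%:C%C) lecR.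
have := Bconvex b bB (x : convex_lmodType X) y (Itv.mk li) xb yb.
rewrite /conv /= (_ : unstable.onem (l%:num)%:C%C = (unstable.onem l%:num)%:C%C)//.
by rewrite /unstable.onem rmorphB.
Qed.

HB.instance Definition _ := Uniform_isTvs.Build R Y realified_locally_convex.
End Realified.

(** * Truncation to an interval *)

Section Clip.
Context (R : realType) (d : R).
Hypothesis d0 : 0 < d.

Definition clip (t : R) : R := Num.max (- d) (Num.min d t).

Lemma clip_continuous : continuous clip.
Proof.
move=> t; apply: (@continuous_max R R (fun=> - d) (fun t => Num.min d t)).
  exact: cst_continuous.
apply: (@continuous_min R R (fun=> d) id); first exact: cst_continuous.
exact: cvg_id.
Qed.

Lemma clipP (t : R) : [\/ [/\ t <= - d & clip t = - d], [/\ - d <= t <= d & clip t = t]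
  | [/\ d <= t & clip t = d]].
Proof.
have dd : - d <= d by have := d0; lra.
rewrite /clip; have [dt|/ltW td] := leP d t.
  by constructor 3; split=> //; rewrite max_r.
have [dt|/ltW td'] := leP (- d) t; first by constructor 2; rewrite td.
by constructor 1.
Qed.

Lemma clip_norm (t : R) : `|clip t| <= d.
Proof. by have := d0; rewrite ler_norml; case: (clipP t) => -[h ->]; lra. Qed.

(** Together with [clip_sub_half], this makes [t - clip (t / 2)] the inverse of [t + clip t]. *)
Lemma clip_half_add (t : R) : clip ((t + clip t) / 2) = clip t.
Proof.
case: (clipP ((t + clip t) / 2)) => -[+ ->]; case: (clipP t) => -[h ->] h'; have := d0; lra.
Qed.

Lemma clip_sub_half (t : R) : clip (t - clip (t / 2)) = clip (t / 2).
Proof.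
case: (clipP (t - clip (t / 2))) => -[+ ->]; case: (clipP (t / 2)) => -[h ->] h'; have := d0; lra.
Qed.

Lemma norm_add_clip (t : R) : d <= `|t| -> `|t + clip t| = `|t| + d.
Proof.
have d_gt0 := d0; have [t0|/ltW t0] := leP 0 t.
  rewrite (ger0_norm t0) => dt; case: (clipP t) => -[h ->].
  - by exfalso; lra.
  - by rewrite ger0_norm; lra.
  - by rewrite ger0_norm; lra.
rewrite (ler0_norm t0) => dt; case: (clipP t) => -[h ->].
- by rewrite ler0_norm; lra.
- by rewrite ler0_norm; lra.
- by exfalso; lra.
Qed.

End Clip.

(** * Shadowing on the real line *)

Section LineDynamics.
Context (R : realType) (X : tvsType R) (T : {linear X -> X}).
Hypotheses (GL_T : in_GL T).
Context (f : {scalar X}) (e : X).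
Hypotheses (cf : continuous f) (fe : f e = 1) (lineX : forall z, z = f z *: e).

Let a := f (T e).

Lemma line_multiplier z : f (T z) = a * f z.
Proof. by rewrite {1}(lineX z) !linearZ /= mulrC. Qed.

Lemma line_multiplier_neq0 : 0 < `|a|.
Proof.
have [_ [T' [_ _ T'K]]] := GL_T.
rewrite normr_gt0; apply/eqP => a0; have := line_multiplier (T' e).
by rewrite T'K fe a0 mul0r => /eqP; rewrite oner_eq0.
Qed.

Lemma nbhs0_functional_le (k : R) : 0 < k -> nbhs (0 : X) [set z | `|f z| <= k].
Proof.
move=> k0; have cf0 : f z @[z --> (0 : X)] --> f 0 by exact: cf.
move/cvgrPdist_le: cf0 => /(_ k k0).
by apply: filterS => z; rewrite linear0 sub0r normrN.
Qed.

Lemma line_nbhs (V : set X) : nbhs 0 V ->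
  exists2 M : R, 0 < M & forall z, `|f z| <= M -> V z.
Proof.
move=> /(nbhs0_absorbing e)[k k0 kV]; exists (k / 2); first by rewrite divr_gt0.
by move=> z zk; rewrite (lineX z); apply: kV; apply: le_lt_trans zk _; lra.
Qed.

(* When |a| = 1, pushing points away from the origin by d at each step is a small
   perturbation of T with an unbounded orbit, while orbits of T stay bounded. *)
Lemma line_multiplier_norm_neq1 : topologically_stable T -> `|a| != 1.
Proof.
move=> stableT; apply/eqP => a1.
have [U U0 stable] := stableT _ (nbhs0_functional_le ltr01).
have [d d0 dU] := line_nbhs U0.
have f_shift z c : f (z + c *: e) = f z + c by rewrite linearD linearZ /= fe mulr1.
pose K z : X := z + clip d (f z) *: e.
have hK : homeomorphism K.
  have clip_f (h : X -> R) : continuous h -> continuous (fun z => clip d (h z) *: e).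
    move=> ch; apply: tvs_continuousZ => z; last exact: cvg_cst.
    by apply: continuous_comp; [exact: ch|exact: clip_continuous].
  have ch : continuous (fun z => f z / 2).
    move=> z; apply: (@continuousM R X f (fun=> 2^-1)); first exact: cf.
    exact: cst_continuous.
  split; first by apply: tvs_continuousD; [move=> z; exact: cvg_id|exact: clip_f].
  exists (fun z => z + - (clip d (f z / 2) *: e)); split.
  - apply: tvs_continuousD; first by move=> z; exact: cvg_id.
    by apply: tvs_continuousN; exact: clip_f.
  - by move=> z; rewrite /K /= f_shift clip_half_add// addrK.
  - by move=> z; rewrite /K /= -scaleNr f_shift clip_sub_half// scaleNr subrK.
have [z|phi [_ Tphi phi1]] := stable (T \o K) (homeomorphism_comp GL_T hK).
  apply: dU; rewrite /= /K linearD opprD addrA subrr add0r linearN /= normrN.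
  by rewrite line_multiplier linearZ /= fe mulr1 normrM a1 mul1r clip_norm.
(* Starting at [d *: e], the truncation is saturated at every step, so the coordinate grows by
   exactly [d] in absolute value. *)
pose z n := iter n (T \o K) (d *: e).
have zS n : z n.+1 = T (K (z n)) by [].
have fz n : `|f (z n)| = d * n.+1%:R.
  elim: n => [|n IHn]; first by rewrite /z /= linearZ /= fe !mulr1 gtr0_norm.
  rewrite zS line_multiplier normrM a1 mul1r.
  rewrite f_shift norm_add_clip// IHn; last by rewrite ler_peMr ?ler1n// ltW.
  by rewrite -[n.+2%:R]natr1; ring.
have fphi n : `|f (phi (z n))| = `|f (phi (z 0%N))|.
  elim: n => // n IHn; by rewrite zS -[phi _](Tphi (z n)) /= line_multiplier normrM a1 mul1r.
have bounded n : d * n.+1%:R <= 1 + `|f (phi (z 0%N))|.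
  rewrite -fz -(fphi n); have := phi1 (z n); rewrite /= linearB /= distrC.
  by move=> /(le_trans (lerB_dist _ _)); lra.
(* The left side of [bounded] grows with [n] while [B] is fixed, contradicting the Archimedean
   property. *)
set B := 1 + _ in bounded.
have B0 : 0 <= B / d by rewrite divr_ge0 ?(ltW d0)// addr_ge0.
have := bounded (Num.bound (B / d)); rewrite leNgt => /negP; apply.
rewrite mulrC -ltr_pdivrMr//; apply: lt_le_trans (archi_boundP B0) _.
by rewrite ler_nat.
Qed.

Hypothesis a1 : `|a| != 1.

Lemma finite_shadowing_line : finite_shadowing T.
Proof.
move=> V /line_nbhs[M M0 MV].
have k0 : 0 < M * `|1 - `|a| | by rewrite mulr_gt0// normr_gt0 subr_eq0 eq_sym.
exists [set z | `|f z| <= M * `|1 - `|a| | ]; first exact: nbhs0_functional_le.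
move=> n x [_ chain].
have step y j : (j < n)%N ->
    `|a * f (x j - iter j T y) - f (x j.+1 - iter j.+1 T y)| <= M * `|1 - `|a| |.
  move=> jn; have := chain j jn; rewrite /= -line_multiplier -linearB /=.
  by rewrite [T (_ - _)]linearB /= opprB addrA subrK.
have [a_lt1|a_gt1] : `|a| < 1 \/ 1 < `|a|.
  by apply/orP; rewrite -neq_lt.
(* For a contraction the error vanishes at time 0 and is propagated forward. *)
- exists (x 0%N) => j jn; apply: MV; move: j jn.
  apply: (contraction_chain_bound (k := M * `|1 - `|a| |) _ (step _)).
    by rewrite [`|1 - _|]gtr0_norm ?subr_gt0//; lra.
  by rewrite /= subrr linear0 normr0 ltW.
- have [_ [T' [_ _ T'K]]] := GL_T.
  have iterT'K y : iter n T (iter n T' y) = y.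
    by elim: n {chain step} y => // m IHm y; rewrite iterS [iter m.+1 T' _]iterSr IHm T'K.
  (* For an expansion the orbit is chosen to end at [x n], and the error is propagated backward. *)
  exists (iter n T' (x n)) => j jn; apply: MV; move: j jn.
  apply: (expansion_chain_bound (k := M * `|1 - `|a| |) _ line_multiplier_neq0 (step _)).
    by rewrite [`|1 - _|]ltr0_norm ?subr_lt0//; lra.
  by rewrite iterT'K subrr linear0 normr0 ltW.
Qed.

Lemma periodic_shadowing_line : strict_periodic_shadowing T.
Proof.
move=> V /line_nbhs[M M0 MV].
have k0 : 0 < M * `|1 - `|a| | by rewrite mulr_gt0// normr_gt0 subr_eq0 eq_sym.
exists [set z | `|f z| <= M * `|1 - `|a| | ]; first exact: nbhs0_functional_le.
move=> n x chain [n0 xn].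
have iterT0 j : iter j T 0 = 0 by elim: j => //= j ->; rewrite linear0.
(* The fixed point 0 shadows every periodic pseudotrajectory with small errors, as these remain near
   0. *)
exists 0; split => // j; rewrite iterT0 subr0; apply: MV.
apply: (periodic_chain_bound (t := f \o x) M0 erefl a1 _ n0) => i; last by rewrite /= xn.
by have := chain i; rewrite /= linearB /= line_multiplier.
Qed.

End LineDynamics.

(** * Case distinction on the dimension and on the field *)

Lemma stable_shadowing_real (R : realType) (X : tvsType R) (hX : hausdorff_space X)
    (T : {linear X -> X}) : in_GL T -> topologically_stable T ->
  finite_shadowing T /\ strict_periodic_shadowing T.
Proof.
move=> GL_T stableT.
have [[e e0]|X0] := pselect (exists e : X, e != 0); last first.
  have {}X0 (x : X) : x = 0 by apply/eqP/negPn/negP => x0; apply: X0; exists x.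
  by split=> V V0; exists setT; [exact: filterT| |exact: filterT|] => k x _ *;
    exists 0; try split => //; move=> *; rewrite (X0 (_ - _)); exact: nbhs_singleton.
have [f [cf fe]] := exists_functional hX e0.
have [lineX|] := pselect (forall z : X, z = f z *: e).
  have a1 := line_multiplier_norm_neq1 GL_T cf fe lineX stableT.
  by split; [exact: finite_shadowing_line a1|exact: periodic_shadowing_line a1].
move=> /existsNP[z /eqP]; rewrite -subr_eq0 => w0.
have [g [cg gw]] := exists_functional hX w0.
set w := z - _ in w0 gw.
have fw : f w = 0 by rewrite linearB linearZ /= fe mulr1 subrr.
(* Subtracting [g e * f] makes the functional vanish at [e] and, since [f w = 0], keeps its value 1
   at [w]. *)
have h_linear : scalar (fun x => g x - g e * f x).
  by move=> b x y; rewrite !linearP /=; ring.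
pose h : {scalar X} := HB.pack (fun x => g x - g e * f x)
  (GRing.isLinear.Build R X R *%R _ h_linear).
have ch : continuous h.
  move=> x; apply: (@continuousB R R^o X g (fun x => g e * f x)); first exact: cg.
  apply: (@continuousM R X (fun=> g e) f); first exact: cst_continuous.
  exact: cf.
have he : h e = 0 by rewrite /= /h /= fe mulr1 subrr.
have hw : h w = 1 by rewrite /= /h /= fw mulr0 subr0.
by split; [exact: finite_shadowing_higher_dim cf ch fe he hw
          |exact: periodic_shadowing_higher_dim cf ch fe he hw].
Qed.

(** Stability and both shadowing properties involve only the topology and the addition, so they are
    the same statements for [X] and for [realified X]. *)
Lemma stable_shadowing_complex (R : realType) (X : tvsType R[i])
    (hX : hausdorff_space X) (T : {linear X -> X}) :
  in_GL T -> topologically_stable T ->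
  finite_shadowing T /\ strict_periodic_shadowing T.
Proof.
pose T0 : realified X -> realified X := T.
have T_linear : linear T0 by move=> a x y; exact: (linearP T).
pose T' : {linear realified X -> realified X} := HB.pack T0
  (GRing.isLinear.Build R (realified X) (realified X) *:%R T0 T_linear).
exact: (@stable_shadowing_real R (realified X) hX T').
Qed.

Theorem theorem13 (R : realType) (K : numFieldType)
    (hK : K = (R : numFieldType) \/ K = (R[i] : numFieldType))
    (X : tvsType K) (hX : hausdorff_space X)
    (T : {linear X -> X}) (hT : in_GL T) (stableT : topologically_stable T) :
  finite_shadowing T /\ strict_periodic_shadowing T.

Proof.
case: hK => hK; subst K; first exact: stable_shadowing_real.
exact: stable_shadowing_complex.
Qed.
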